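(* Let $(\mathfrak{g}, [\cdot,\dots,\cdot])$ be an $n$-Lie superalgebra over a field $\mathbb{K}$, let $S : \mathfrak{g} \to \mathbb{K}$ be a supertrace of $[\cdot,\dots,\cdot]$, and let $(\mathfrak{g}_S, [\cdot,\dots,\cdot]_S)$ be the $(n+1)$-Lie superalgebra induced by $S$. Denote the descending central series of $\mathfrak{g}$ by $(C^p(\mathfrak{g}))_{p=0}^\infty$ and that of $\mathfrak{g}_S$ by $(C^p(\mathfrak{g}_S))_{p=0}^\infty$. Then $$C^p(\mathfrak{g}_S) \subseteq C^p(\mathfrak{g}) \quad \text{for all } p \in \mathbb{N}.$$ If moreover there exists $g \in \mathfrak{g}$ such that $[g, x_1, \dots, x_n]_S = [x_1, \dots, x_n]$ holds for all $x_1, x_2, \dots, x_n \in \mathfrak{g}$, then $$C^p(\mathfrak{g}_S) = C^p(\mathfrak{g}) \quad \text{for all } p \in \mathbb{N}.$$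
   Context: A super vector space is a direct sum $V = V_{\overline 0} \oplus V_{\overline 1}$; a nonzero element $x$ is homogeneous if $x \in V_{\overline 0}$ (parity $|x| = \overline 0$) or $x \in V_{\overline 1}$ (parity $|x| = \overline 1$). Whenever $|x|$ is written, $x$ is assumed homogeneous; identities involving parities are stated for homogeneous elements and extended by multilinearity. For $\mathrm{x} = (x_1, x_2, \dots)$ write $|\mathrm{x}|_i = \sum_{j=1}^{i} |x_j|$ (so $|\mathrm{x}|_0=\overline 0$). Here $\mathbb{N}$ includes $0$. An $n$-Lie superalgebra ($n \ge 2$) is a super vector space $\mathfrak{g}$ over $\mathbb{K}$ with an $n$-linear map $[\cdot,\dots,\cdot] : \mathfrak{g}^n \to \mathfrak{g}$ such that (1) $|[x_1,\dots,x_n]| = \sum_{i=1}^n |x_i|$; (2) $[x_1,\dots,x_i,x_{i+1},\dots,x_n] = -(-1)^{|x_i||x_{i+1}|}[x_1,\dots,x_{i+1},x_i,\dots,x_n]$; (3) (graded Filippov identity) $[y_1,\dots,y_{n-1},[x_1,\dots,x_n]] = \sum_{i=1}^n (-1)^{|\mathrm{x}|_{i-1}|\mathrm{y}|_{n-1}} [x_1,\dots,x_{i-1},[y_1,\dots,y_{n-1},x_i],x_{i+1},\dots,x_n]$. A supertrace of $[\cdot,\dots,\cdot]$ is a linear map $S:\mathfrak{g}\to\mathbb{K}$ with $S([x_1,\dots,x_n]) = 0$ for all $x_1,\dots,x_n\in\mathfrak{g}$ and $S(x)=0$ for all $x \in \mathfrak{g}_{\overline 1}$. The induced bracket $[\cdot,\dots,\cdot]_S:\mathfrak{g}^{n+1}\to\mathfrak{g}$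 is $$[x_1,\dots,x_{n+1}]_S = \sum_{i=1}^{n+1} (-1)^{i-1}(-1)^{|x_i||\mathrm{x}|_{i-1}} S(x_i)[x_1,\dots,x_{i-1},x_{i+1},\dots,x_{n+1}].$$ The super vector space $\mathfrak{g}$ with this bracket is denoted $\mathfrak{g}_S$; it is known to be an $(n+1)$-Lie superalgebra, called the induced $(n+1)$-Lie superalgebra. The descending central series of an ideal $\mathfrak{h}$ (in particular of the whole algebra) of a $k$-Lie superalgebra is $C^0(\mathfrak{h})=\mathfrak{h}$, $C^{p+1}(\mathfrak{h})=[C^p(\mathfrak{h}),\mathfrak{h},\dots,\mathfrak{h}]$, where the $k$-ary bracket of subspaces is the span of all brackets of their elements. For $\mathfrak{g}$ the bracket $[\cdot,\dots,\cdot]$ is used, for $\mathfrak{g}_S$ the bracket $[\cdot,\dots,\cdot]_S$. *)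

(* Defs.v *)
From mathcomp Require Import all_boot all_order all_fingroup all_algebra.
From mathcomp Require Import boolp classical_sets.

Set Implicit Arguments.
Unset Strict Implicit.
Unset Printing Implicit Defensive.

Import GRing.Theory.
Local Open Scope classical_set_scope.
Local Open Scope ring_scope.

Definition subspace (K : fieldType) (V : lmodType K) (A : set V) : Prop :=
  A 0 /\ forall (a : K) (u v : V), A u -> A v -> A (a *: u + v).

Definition linear_span (K : fieldType) (V : lmodType K) (A : set V) : set V :=
  smallest (@subspace K V) A.

(* V = V_0 (+) V_1. Parities are booleans ([false] is even, [true] is odd,
   addition is [addb], multiplication is [andb]). [gpart b] is the set of
   elements of parity b together with 0. *)
Record super_grading (K : fieldType) (V : lmodType K) := SuperGrading {
  gpart : bool -> set V;
  gpart_subspace : forall b, subspace (gpart b);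
  gpart_sum : forall x, exists x0 x1,
    [/\ gpart false x0, gpart true x1 & x = x0 + x1];
  gpart_direct : gpart false `&` gpart true `<=` [set 0]
}.

(* The component of x of parity b: the u in V_b such that x - u has the other
   parity. The default value 0 is never used, see [component_spec]. *)
Definition component (K : fieldType) (V : lmodType K) (gr : super_grading V)
    (b : bool) (x : V) : V :=
  xget 0 [set u | gpart gr b u /\ gpart gr (~~ b) (x - u)].

(* The prefix parity |x|_k = |x_1| + ... + |x_k|, the parity of the i-th
   element (counted from 0) being p i. *)
Definition prefix_parity (n : nat) (p : 'I_n -> bool) (k : nat) : bool :=
  \big[addb/false]_(j < n | (j < k)%N) p j.

(* (g, x_1, ..., x_n) *)
Definition vcons (T : Type) (n : nat) (g : T) (x : 'I_n -> T) : 'I_n.+1 -> T :=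
  fun i => oapp x g (unlift ord0 i).

(* (y_1, ..., y_(n-1), z), for n > 0 *)
Definition vrcons (T : Type) (n : nat) (y : 'I_n.-1 -> T) (z : T) : 'I_n -> T :=
  fun i => oapp y z (insub (i : nat) : option 'I_n.-1).

Definition multilinear (K : fieldType) (V : lmodType K) (n : nat)
    (br : ('I_n -> V) -> V) : Prop :=
  forall (i : 'I_n) (x : 'I_n -> V) (a : K) (u v : V),
    br [eta x with i |-> a *: u + v] =
    a *: br [eta x with i |-> u] + br [eta x with i |-> v].

(* Since 0 lies in both [gpart false] and [gpart true], the identities below
   are also required when some entries vanish; both sides are then 0. *)
Record nLie_superalgebra (K : fieldType) (V : lmodType K)
    (gr : super_grading V) (n : nat) (br : ('I_n -> V) -> V) : Prop := {
  nLie_arity : (2 <= n)%N;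
  nLie_multilinear : multilinear br;
  nLie_parity : forall (p : 'I_n -> bool) (x : 'I_n -> V),
    (forall i, gpart gr (p i) (x i)) ->
    gpart gr (\big[addb/false]_(i < n) p i) (br x);
  nLie_skew : forall (p : 'I_n -> bool) (x : 'I_n -> V) (i j : 'I_n),
    (forall k, gpart gr (p k) (x k)) -> j = i.+1 :> nat ->
    br x = - ((-1) ^+ (p i && p j) *: br (x \o tperm i j));
  nLie_Filippov : forall (q : 'I_n.-1 -> bool) (y : 'I_n.-1 -> V)
      (p : 'I_n -> bool) (x : 'I_n -> V),
    (forall i, gpart gr (q i) (y i)) -> (forall i, gpart gr (p i) (x i)) ->
    br (vrcons y (br x)) =
    \sum_(i < n) (-1) ^+ (prefix_parity p i && prefix_parity q n.-1)
       *: br [eta x with i |-> br (vrcons y (x i))]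
}.

Definition supertrace (K : fieldType) (V : lmodType K) (gr : super_grading V)
    (n : nat) (br : ('I_n -> V) -> V) (S : {scalar V}) : Prop :=
  (forall x : 'I_n -> V, S (br x) = 0) /\
  (forall x : V, gpart gr true x -> S x = 0).

(* The formula for [x_1, ..., x_(n+1)]_S when x_i is homogeneous of parity
   p i; [x \o lift i] is x with its i-th entry removed. *)
Definition induced_homogeneous (K : fieldType) (V : lmodType K) (n : nat)
    (br : ('I_n -> V) -> V) (S : {scalar V})
    (p : 'I_n.+1 -> bool) (x : 'I_n.+1 -> V) : V :=
  \sum_(i < n.+1)
    ((-1) ^+ i * (-1) ^+ (p i && prefix_parity p i) * S (x i))
      *: br (x \o lift i).

(* Its extension by multilinearity to arbitrary arguments. *)
Definition induced_bracket (K : fieldType) (V : lmodType K)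
    (gr : super_grading V) (n : nat) (br : ('I_n -> V) -> V) (S : {scalar V}) :
    ('I_n.+1 -> V) -> V :=
  fun x => \sum_(p : {ffun 'I_n.+1 -> bool})
    induced_homogeneous br S p (fun i => component gr (p i) (x i)).

Definition bracket_of_subspaces (K : fieldType) (V : lmodType K) (n : nat)
    (br : ('I_n -> V) -> V) (A : 'I_n -> set V) : set V :=
  linear_span [set br x | x in [set x | forall i, A i (x i)]].

Fixpoint descending_central_series (K : fieldType) (V : lmodType K) (n : nat)
    (br : ('I_n -> V) -> V) (H : set V) (p : nat) : set V :=
  if p is p'.+1 then
    bracket_of_subspaces br (fun i : 'I_n =>
      if i == 0%N :> nat then descending_central_series br H p' else H)
  else H.

Lemma component_spec (K : fieldType) (V : lmodType K) (gr : super_grading V)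
    (b : bool) (x : V) :
  gpart gr b (component gr b x) /\ gpart gr (~~ b) (x - component gr b x).
Proof.
rewrite /component; case: xgetP => [u _ //|noP].
have [x0 [x1 [h0 h1 ex]]] := gpart_sum gr x; case: b noP => noP.
  by case: (noP x1); split; rewrite //= ex addrK.
by case: (noP x0); split; rewrite //= ex addrC addKr.
Qed.

Lemma component_uniq (K : fieldType) (V : lmodType K) (gr : super_grading V)
    (b : bool) (x u : V) :
  gpart gr b u -> gpart gr (~~ b) (x - u) -> component gr b x = u.
Proof.
move=> hu hxu; have [hc hxc] := component_spec gr b x.
have sub c v w : gpart gr c v -> gpart gr c w -> gpart gr c (v - w).
  move=> hv hw; rewrite addrC -scaleN1r.
  by apply: (gpart_subspace gr c).2.
have hd : gpart gr b (component gr b x - u) by exact: sub.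
have hd' : gpart gr (~~ b) (component gr b x - u).
  have -> : component gr b x - u = (x - u) - (x - component gr b x).
    by rewrite opprB [RHS]addrC addrA subrK.
  exact: sub.
apply/eqP; rewrite -subr_eq0; apply/eqP; apply: (@gpart_direct _ _ gr).
by case: b hd hd' {hu hxu hc hxc}; split.
Qed.

Lemma component_linear (K : fieldType) (V : lmodType K) (gr : super_grading V)
    (b : bool) (a : K) (u v : V) :
  component gr b (a *: u + v) = a *: component gr b u + component gr b v.
Proof.
have [hu hu'] := component_spec gr b u; have [hv hv'] := component_spec gr b v.
apply: component_uniq; first by apply: (gpart_subspace gr b).2.
rewrite opprD addrACA -scalerBr; exact: (gpart_subspace gr _).2.
Qed.

Lemma component_homogeneous (K : fieldType) (V : lmodType K)
    (gr : super_grading V) (b c : bool) (x : V) :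
  gpart gr c x -> component gr b x = if b == c then x else 0.
Proof.
move=> hx; apply: component_uniq; case: eqP => [->//|/eqP nbc].
- exact: (gpart_subspace gr _).1.
- by rewrite subrr; exact: (gpart_subspace gr _).1.
- by rewrite subr0; have -> : ~~ b = c by case: b c nbc {hx} => [] [].
Qed.

Lemma multilinear_zero (K : fieldType) (V : lmodType K) (n : nat)
    (br : ('I_n -> V) -> V) (i : 'I_n) (x : 'I_n -> V) :
  multilinear br -> x i = 0 -> br x = 0.
Proof.
move=> ml x0; have := ml i x 1 0 0; rewrite !scale1r addr0.
have -> : [eta x with i |-> 0] = x :> ('I_n -> V).
  by apply/funext => j /=; case: eqP => // ->.
by move/(congr1 (fun t => t - br x)); rewrite subrr addrK.
Qed.

(* On homogeneous elements the induced bracket is given by its formula. *)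
Lemma induced_bracket_homogeneous (K : fieldType) (V : lmodType K)
    (gr : super_grading V) (n : nat) (br : ('I_n -> V) -> V) (S : {scalar V})
    (p : 'I_n.+1 -> bool) (x : 'I_n.+1 -> V) :
  multilinear br -> (forall i, gpart gr (p i) (x i)) ->
  induced_bracket gr br S x = induced_homogeneous br S p x.
Proof.
move=> ml hx; rewrite /induced_bracket (bigD1 [ffun i => p i]) //=.
rewrite big1 ?addr0 => [|q /eqP nqp].
  have -> : (fun i => component gr ([ffun i0 => p i0] i) (x i)) = x.
    apply/funext => i; rewrite ffunE.
    by rewrite (component_homogeneous _ (hx i)) eqxx.
  by congr induced_homogeneous; apply/funext => i; rewrite ffunE.
have [i nqi] : exists i, q i != p i.
  apply/existsP; apply: contra_notT nqp; rewrite negb_exists => /forallP e.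
  by apply/ffunP => i; rewrite ffunE; apply/eqP/negPn/e.
have ci : component gr (q i) (x i) = 0.
  by rewrite (component_homogeneous _ (hx i)) (negPf nqi).
rewrite /induced_homogeneous big1 // => j _.
have [->|nij] := eqVneq j i; first by rewrite ci linear0 mulr0 scale0r.
have [k ek _] := unlift_some nij.
rewrite (@multilinear_zero _ _ _ br k) ?scaler0 //=.
by rewrite -ek.
Qed.

Lemma induced_homogeneous_multilinear (K : fieldType) (V : lmodType K)
    (n : nat) (br : ('I_n -> V) -> V) (S : {scalar V}) (p : 'I_n.+1 -> bool) :
  multilinear br -> multilinear (induced_homogeneous br S p).
Proof.
move=> ml i x a u v; rewrite /induced_homogeneous scaler_sumr -big_split /=.
apply: eq_bigr => j _.
have [->|nji] := eqVneq j i.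
  have E w : [eta x with i |-> w] \o lift i = x \o lift i.
    by apply/funext => k /=; rewrite eq_sym (negPf (neq_lift i k)).
  by rewrite !E linearP mulrDr mulrCA scalerDl scalerA.
have [k ek _] := unlift_some nji.
have E w : [eta x with i |-> w] \o lift j = [eta (x \o lift j) with k |-> w].
  apply/funext => l /=; rewrite ek (inj_eq (@lift_inj _ j)).
  by case: eqP.
by rewrite !E ml scalerDr !scalerA (mulrC _ a).
Qed.

Lemma induced_bracket_multilinear (K : fieldType) (V : lmodType K)
    (gr : super_grading V) (n : nat) (br : ('I_n -> V) -> V) (S : {scalar V}) :
  multilinear br -> multilinear (induced_bracket gr br S).
Proof.
move=> ml i x a u v; rewrite /induced_bracket scaler_sumr -big_split /=.
apply: eq_bigr => p _.
have E w : (fun j => component gr (p j) ([eta x with i |-> w] j)) =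
  [eta (fun j => component gr (p j) (x j)) with i |-> component gr (p i) w].
  by apply/funext => j /=; case: eqP => // ->.
by rewrite !E component_linear (induced_homogeneous_multilinear _ _ ml).
Qed.

(* Main.v *)
Require Import Defs.
From mathcomp Require Import all_boot all_order all_fingroup all_algebra.
From mathcomp Require Import boolp classical_sets.

Set Implicit Arguments.
Unset Strict Implicit.
Unset Printing Implicit Defensive.

Import GRing.Theory.
Local Open Scope classical_set_scope.
Local Open Scope ring_scope.

(** As S vanishes on odd elements, every sign (-1)^(|x_i||x|_(i-1)) in the
    formula for the induced bracket stands in front of a term which is already
    zero unless |x_i| is even, that is, unless the sign is 1.  Hence
      [x_1, ..., x_(n+1)]_S = sum_i (-1)^(i-1) S(x_i) [x_1, .., no x_i, .., x_(n+1)]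
    for arbitrary, not necessarily homogeneous, arguments
    ([induced_bracketE]).

    Inclusion, by induction on p.  Let x_1 lie in C^p(g).  The terms with i > 1
    keep x_1 in first position, so they lie in C^(p+1)(g).  The term i = 1 lies
    in C^1(g), which suffices if p = 0; if p > 0 it is zero, since C^p(g) is
    then spanned by brackets, which S kills.

    Equality.  Comparing parities in [g, x_1, ..., x_n]_S = [x_1, ..., x_n]
    shows that the odd part of g contributes nothing, so g may be assumed even
    ([even_unit_exists]).  An even g can be exchanged with x_1 at the cost of a
    plain sign, whatever x_1 is ([induced_skew_even]), so
      [x_1, ..., x_n] = - [x_1, g, x_2, ..., x_n]_S,
    and the right-hand side lies in C^(p+1)(g_S) as soon as x_1 lies in
    C^p(g_S).  Identities known for homogeneous arguments are extended to all
    arguments by [multilinear_eq]. *)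

(** * Subspaces and spans *)

Section Subspaces.
Variables (K : fieldType) (V : lmodType K).
Implicit Types A B : set V.

Lemma subspaceZ A a u : subspace A -> A u -> A (a *: u).
Proof. by case=> A0 AD Au; rewrite -[_ *: _]addr0; apply: AD. Qed.

Lemma subspaceD A u v : subspace A -> A u -> A v -> A (u + v).
Proof. by case=> A0 AD Au Av; rewrite -[u]scale1r; apply: AD. Qed.

Lemma subspaceN A u : subspace A -> A u -> A (- u).
Proof. by move=> sA Au; rewrite -scaleN1r; apply: subspaceZ. Qed.

Lemma subspace_sum A (I : finType) (F : I -> V) :
  subspace A -> (forall i, A (F i)) -> A (\sum_i F i).
Proof.
move=> sA AF; apply: (big_ind A) => // [|u v]; first by case: sA.
exact: subspaceD.
Qed.

Lemma subspace_span A : subspace (linear_span A).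
Proof.
split=> [B [[B0 _] _] //|a u v hu hv B [sB AB]].
by apply: sB.2; [apply: hu|apply: hv].
Qed.

Lemma linear_span_sub A B : subspace B -> A `<=` B -> linear_span A `<=` B.
Proof. by move=> sB AB u; apply. Qed.

Lemma sub_linear_span A : A `<=` linear_span A.
Proof. by move=> u Au B [_]; apply. Qed.

End Subspaces.

(** * Multilinear maps and homogeneous arguments *)

Section Multilinear.
Variables (K : fieldType) (V : lmodType K).

(** The entries are split into summands in B one at a time, from the first to
    the last. *)
Lemma multilinear_eq n (f h : ('I_n -> V) -> V) (B D : 'I_n -> set V) :
  multilinear f -> multilinear h ->
  (forall i u, D i u -> exists u0 u1, [/\ B i u0, B i u1 & u = u0 + u1]) ->
  (forall x, (forall i, B i (x i)) -> f x = h x) ->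
  forall x, (forall i, D i (x i)) -> f x = h x.
Proof.
move=> mf mh split_D fhB x Dx.
suff main m y : (forall i : 'I_n, (m <= i)%N -> B i (y i)) ->
    (forall i : 'I_n, (i < m)%N -> D i (y i)) -> f y = h y.
  by apply: (main n) => i; rewrite ?Dx // leqNgt ltn_ord.
elim: m y => [|m IHm] y By Dy; first by apply: fhB => i; apply: By.
have [lt_mn|le_nm] := ltnP m n; last first.
  have lt_m (i : 'I_n) : (i < m)%N := leq_trans (ltn_ord i) le_nm.
  by apply: IHm => i; [rewrite leqNgt lt_m|move/leqW/Dy].
pose k := Ordinal lt_mn.
have [u0 [u1 [B0 B1 ey]]] := split_D k _ (Dy k (leqnn _)).
have agree u : B k u -> f [eta y with k |-> u] = h [eta y with k |-> u].
  move=> Bu; apply: IHm => i /= le_i.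
    case: eqP => [-> //|/eqP ne_ik]; apply: By.
    by rewrite ltn_neqAle le_i andbT eq_sym.
  case: eqP => [e|_]; last by apply/Dy/leqW.
  by move: le_i; rewrite e ltnn.
have -> : y = [eta y with k |-> 1 *: u0 + u1].
  by apply/funext => i /=; rewrite scale1r; case: eqP => // ->.
by rewrite mf mh !agree.
Qed.

Lemma multilinear_comp_perm n (f : ('I_n -> V) -> V) (s : 'S_n) :
  multilinear f -> multilinear (fun x => f (x \o s)).
Proof.
move=> mf i x a u v.
have E w : [eta x with i |-> w] \o s = [eta (x \o s) with (s^-1)%g i |-> w].
  apply/funext => j /=; congr (if _ then _ else _).
  by rewrite -(inj_eq (@perm_inj _ s)) permKV.
by rewrite !E mf.
Qed.

Lemma multilinear_opp n (f : ('I_n -> V) -> V) :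
  multilinear f -> multilinear (fun x => - f x).
Proof. by move=> mf i x a u v; rewrite mf opprD scalerN. Qed.

Lemma vcons0 n g (x : 'I_n -> V) : vcons g x ord0 = g.
Proof. by rewrite /vcons unlift_none. Qed.

Lemma vconsS n g (x : 'I_n -> V) i : vcons g x (lift ord0 i) = x i.
Proof. by rewrite /vcons liftK. Qed.

Lemma vcons_with n g (x : 'I_n -> V) i u :
  vcons g [eta x with i |-> u] = [eta vcons g x with lift ord0 i |-> u].
Proof.
apply/funext => j; have [->|[k ->]] : j = ord0 \/ exists k, j = lift ord0 k.
    by case: (unliftP ord0 j) => [k|] ->; [right; exists k|left].
  by rewrite /= !vcons0.
by rewrite /= !vconsS (inj_eq (@lift_inj _ ord0)).
Qed.

Lemma multilinear_vcons n (f : ('I_n.+1 -> V) -> V) g :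
  multilinear f -> multilinear (fun x => f (vcons g x)).
Proof. by move=> mf i x a u v; rewrite !vcons_with mf. Qed.

Lemma multilinear_vcons_head n (f : ('I_n.+1 -> V) -> V) (x : 'I_n -> V) u v :
  multilinear f -> f (vcons (u + v) x) = f (vcons u x) + f (vcons v x).
Proof.
move=> mf; have E w : vcons w x = [eta vcons 0 x with ord0 |-> w].
  by apply/funext => j; rewrite /vcons /=; case: unliftP => [k|] ->.
by rewrite (E (u + v)) (E u) (E v) -{1}[u]scale1r mf scale1r.
Qed.

Variable gr : super_grading V.

Definition homogeneous (u : V) : Prop := exists b, gpart gr b u.

Lemma homogeneous_split u :
  exists u0 u1, [/\ homogeneous u0, homogeneous u1 & u = u0 + u1].
Proof.
have [u0 [u1 [h0 h1 e]]] := gpart_sum gr u.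
by exists u0, u1; split=> //; [exists false|exists true].
Qed.

Lemma homogeneous_parity n (x : 'I_n -> V) :
  (forall i, homogeneous (x i)) ->
  exists p : 'I_n -> bool, forall i, gpart gr (p i) (x i).
Proof. by move=> /boolp.choice[p hp]; exists p. Qed.

Lemma multilinear_eq_homogeneous n (f h : ('I_n -> V) -> V) :
  multilinear f -> multilinear h ->
  (forall p x, (forall i, gpart gr (p i) (x i)) -> f x = h x) ->
  f =1 h.
Proof.
move=> mf mh fh x; apply: (@multilinear_eq _ _ _ (fun=> homogeneous)
  (fun=> setT)) => // [i u _|y /homogeneous_parity[p hy]].
  exact: homogeneous_split.
exact: fh hy.
Qed.

End Multilinear.

(** * The induced bracket *)

Section Induced.
Variables (K : fieldType) (V : lmodType K) (gr : super_grading V).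

(** With p constantly even the homogeneous formula has no parity signs; it is
    multilinear for every p, so it suffices to compare it with the induced
    bracket on homogeneous arguments. *)
Lemma induced_bracketE n (br : ('I_n -> V) -> V) (S : {scalar V}) x :
  nLie_superalgebra gr br -> supertrace gr br S ->
  induced_bracket gr br S x =
  \sum_(i < n.+1) ((-1) ^+ i * S (x i)) *: br (x \o lift i).
Proof.
move=> Hbr [_ S_odd]; have ml := nLie_multilinear Hbr.
transitivity (induced_homogeneous br S (fun=> false) x); last first.
  by apply: eq_bigr => i _; rewrite mulr1.
apply: (multilinear_eq_homogeneous (gr := gr)) => [||p y hy].
- exact: induced_bracket_multilinear.
- exact: induced_homogeneous_multilinear.
rewrite (induced_bracket_homogeneous _ ml hy).
apply: eq_bigr => i _; case pi: (p i); last by [].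
have -> : S (y i) = 0 by apply: S_odd; rewrite -pi.
by rewrite !mulr0 !scale0r.
Qed.

(** S x_i is zero unless x_i is even, and omitting an even entry does not
    change the total parity. *)
Lemma induced_parity n (br : ('I_n -> V) -> V) (S : {scalar V}) p x :
  nLie_superalgebra gr br -> supertrace gr br S ->
  (forall i, gpart gr (p i) (x i)) ->
  gpart gr (\big[addb/false]_(i < n.+1) p i) (induced_bracket gr br S x).
Proof.
move=> Hbr HS hx; rewrite induced_bracketE //.
have sg := gpart_subspace gr; apply: (subspace_sum (sg _)) => i.
case pi: (p i).
  have -> : S (x i) = 0 by apply: HS.2; rewrite -pi.
  by rewrite mulr0 scale0r; case: (sg (\big[addb/false]_(j < n.+1) p j)).
apply: subspaceZ => //; rewrite (bigD1_ord i) //= pi.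
by apply: (nLie_parity Hbr (p := p \o lift i)) => k; apply: hx.
Qed.

(** The entry x i being even, the parity of x j does not affect the sign, so
    the super skew-symmetry extends to an arbitrary x j. *)
Lemma nLie_skew_even n (br : ('I_n -> V) -> V) (i j : 'I_n) x :
  nLie_superalgebra gr br -> j = i.+1 :> nat -> gpart gr false (x i) ->
  br x = - br (x \o tperm i j).
Proof.
move=> Hbr ij xi; have ml := nLie_multilinear Hbr.
have sg := gpart_subspace gr.
pose even_at k : set V := fun u => k = i -> gpart gr false u.
apply: (multilinear_eq (B := fun k u => homogeneous gr u /\ even_at k u)
  (D := even_at) ml (multilinear_opp (multilinear_comp_perm (tperm i j) ml))).
- move=> k u; rewrite /even_at; have [-> /(_ erefl) u_even|ne_ki _] := eqVneq k i.
    exists u, 0; rewrite addr0; split=> //; split=> [|_ //]; first by exists false.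
      by exists false; case: (sg false).
    by case: (sg false).
  have [u0 [u1 [h0 h1 e]]] := homogeneous_split gr u.
  by exists u0, u1; split=> //; split=> // /eqP; rewrite (negPf ne_ki).
- move=> y hy; have [p hp] := homogeneous_parity (fun k => (hy k).1).
  (* p may be odd at i if y i = 0. *)
  pose q k := if k == i then false else p k.
  have hq k : gpart gr (q k) (y k).
    by rewrite /q; case: eqP => [/(hy k).2|].
  by rewrite (nLie_skew Hbr hq ij) {1}/q eqxx scale1r.
- by move=> k ->.
Qed.

(** In the formula for the induced bracket the terms that omit one of the two
    swapped entries are exchanged; in the other terms these entries remain
    adjacent in first position. *)
Lemma induced_skew_even n (br : ('I_n.+2 -> V) -> V) (S : {scalar V})
    (x : 'I_n.+3 -> V) :
  nLie_superalgebra gr br -> supertrace gr br S -> gpart gr false (x ord0) ->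
  induced_bracket gr br S x =
  - induced_bracket gr br S (x \o tperm ord0 (lift ord0 ord0)).
Proof.
move=> Hbr HS x0; rewrite !induced_bracketE //.
set t := tperm _ _; set i1 : 'I_n.+3 := lift ord0 ord0.
have t0 : t ord0 = i1 by rewrite /t tpermL.
have t1 : t i1 = ord0 by rewrite /t tpermR.
have omit01 (y : 'I_n.+3 -> V) : y \o t \o lift ord0 = y \o lift i1.
  apply/funext => k /=; congr (y _).
  have [->|[l ->]] : k = ord0 \/ exists l, k = lift ord0 l.
      by case: (unliftP ord0 k) => [l|] ->; [right; exists l|left].
    by rewrite t1; apply: val_inj.
  by rewrite tpermD; [apply: val_inj| |].
have omit10 : x \o t \o lift i1 = x \o lift ord0.
  rewrite -omit01; apply/funext => k /=.
  by rewrite tpermK.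
have split2 (F : 'I_n.+3 -> V) : \sum_i F i =
    F ord0 + F i1 + \sum_(i < n.+1) F (lift ord0 (lift ord0 i)).
  by rewrite 2!big_ord_recl addrA.
rewrite !split2 omit01 omit10 /= t0 t1 opprD -sumrN.
congr (_ + _).
  rewrite /bump /= expr0 expr1 !mul1r !mulN1r !scaleNr.
  by rewrite opprD opprK addrC.
apply: eq_bigr => k _; set i := lift ord0 (lift ord0 k).
have lift0 : lift i ord0 = ord0 by apply: val_inj.
have lift1 : lift i (lift ord0 ord0) = i1 by apply: val_inj.
have -> : x \o t \o lift i = (x \o lift i) \o tperm ord0 (lift ord0 ord0).
  by apply/funext => l /=; rewrite (inj_tperm _ _ _ (@lift_inj _ i)) lift0 lift1.
have -> : t i = i by rewrite /t tpermD.
by rewrite (@nLie_skew_even _ _ ord0 (lift ord0 ord0)) //= ?lift0 // scalerN.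
Qed.

(** On homogeneous x the brackets [x] and [g_0, x]_S have parity |x|, whereas
    [g_1, x]_S has parity |x| + 1; as [x] = [g_0, x]_S + [g_1, x]_S, the last
    one is zero. *)
Lemma even_unit_exists n (br : ('I_n -> V) -> V) (S : {scalar V}) g :
  nLie_superalgebra gr br -> supertrace gr br S ->
  (forall x, induced_bracket gr br S (vcons g x) = br x) ->
  exists2 g0, gpart gr false g0 &
    forall x, induced_bracket gr br S (vcons g0 x) = br x.
Proof.
move=> Hbr HS unit_g; have ml := nLie_multilinear Hbr.
have mi : multilinear (induced_bracket gr br S).
  exact: induced_bracket_multilinear.
have [g0 [g1 [h0 h1 eg]]] := gpart_sum gr g; exists g0 => // x.
apply: (multilinear_eq_homogeneous (gr := gr) (multilinear_vcons g0 mi) ml).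
move=> p {}x hx; set P := \big[addb/false]_(i < n) p i.
have parity_vcons b u : gpart gr b u ->
    gpart gr (b (+) P) (induced_bracket gr br S (vcons u x)).
  move=> hu; pose q i := oapp p b (unlift ord0 i).
  have -> : b (+) P = \big[addb/false]_(i < n.+1) q i.
    rewrite big_ord_recl /q unlift_none; congr (_ (+) _).
    by apply: eq_bigr => i _; rewrite liftK.
  apply: induced_parity => // i; rewrite /q /vcons.
  by case: unliftP => [k|] _ /=.
have := unit_g x; rewrite eg multilinear_vcons_head // => ex.
have diff : br x - induced_bracket gr br S (vcons g0 x) =
    induced_bracket gr br S (vcons g1 x) by rewrite -ex addrC addKr.
(* Both sides are the component of parity |x| of [x]. *)
rewrite -(component_uniq (parity_vcons _ _ h0) (x := br x)); last first.
  by rewrite diff /=; exact: parity_vcons h1.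
by rewrite (component_homogeneous _ (nLie_parity Hbr hx)) eqxx.
Qed.

End Induced.

(** * Descending central series *)

Section CentralSeries.
Variables (K : fieldType) (V : lmodType K).

Lemma subspace_central_seriesS n (br : ('I_n -> V) -> V) p :
  subspace (descending_central_series br setT p.+1).
Proof. exact: subspace_span. Qed.

Lemma central_seriesS n (br : ('I_n -> V) -> V) p x :
  (forall i : 'I_n, i = 0%N :> nat ->
     descending_central_series br setT p (x i)) ->
  descending_central_series br setT p.+1 (br x).
Proof.
move=> hx; apply: sub_linear_span; exists x => //= i.
by case: eqP => // /hx.
Qed.

Lemma central_seriesS_sub n (br : ('I_n -> V) -> V) p (A : set V) :
  subspace A ->
  (forall x, (forall i : 'I_n, i = 0%N :> nat ->
     descending_central_series br setT p (x i)) -> A (br x)) ->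
  descending_central_series br setT p.+1 `<=` A.
Proof.
move=> sA hA; apply: linear_span_sub => // _ [x hx <-].
by apply: hA => i i0; have := hx i; rewrite i0.
Qed.

Lemma linear_central_seriesS n (br : ('I_n -> V) -> V) (S : {scalar V}) p u :
  (forall x, S (br x) = 0) ->
  descending_central_series br setT p.+1 u -> S u = 0.
Proof.
move=> Sbr; apply: (central_seriesS_sub (A := [set v | S v = 0])) => [|x _ //].
split=> [|a v w /= Sv Sw]; first exact: linear0.
by rewrite linearP Sv Sw /= mulr0 addr0.
Qed.

End CentralSeries.

Theorem proposition4 (K : fieldType) (V : lmodType K) (gr : super_grading V)
    (n : nat) (br : ('I_n -> V) -> V) (Hbr : nLie_superalgebra gr br)
    (S : {scalar V}) (HS : supertrace gr br S) :
  (forall p : nat,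
     descending_central_series (induced_bracket gr br S) setT p `<=`
     descending_central_series br setT p) /\
  ((exists g : V, forall x : 'I_n -> V,
      induced_bracket gr br S (vcons g x) = br x) ->
   forall p : nat,
     descending_central_series (induced_bracket gr br S) setT p =
     descending_central_series br setT p).
Proof.
have incl p : descending_central_series (induced_bracket gr br S) setT p `<=`
    descending_central_series br setT p.
  elim: p => // p IHp; have sC := subspace_central_seriesS br p.
  apply: (central_seriesS_sub sC) => x hx; rewrite induced_bracketE //.
  apply: (subspace_sum sC) => i.
  have [i0|ni0] := eqVneq i ord0; last first.
    (* The first entry of x is not the omitted one. *)
    apply: (subspaceZ _ sC); apply: central_seriesS => k k0 /=.
    apply/IHp/hx; rewrite /= k0 /bump leqn0.
    by have := ni0; rewrite -val_eqE /= => /negPf ->.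
  case: p IHp hx sC => [|p] IHp hx sC.
    by apply: (subspaceZ _ sC); apply: central_seriesS.
  have -> : S (x i) = 0.
    have/hx/IHp : i = 0%N :> nat by rewrite i0.
    exact: linear_central_seriesS HS.1.
  by rewrite mulr0 scale0r; case: sC.
split=> // -[g unit_g] p; apply/seteqP; split=> //.
case: n br Hbr HS incl unit_g => [|[|n]] br Hbr HS _ unit_g;
  try by have := nLie_arity Hbr.
have [g0 g0_even unit_g0] := even_unit_exists Hbr HS unit_g.
elim: p => // p IHp.
have sC := subspace_central_seriesS (induced_bracket gr br S) p.
apply: (central_seriesS_sub sC) => x hx.
rewrite -unit_g0 (induced_skew_even Hbr HS) ?vcons0 //.
apply: (subspaceN sC); apply: central_seriesS => i i0; apply: IHp => /=.
have -> : i = ord0 by apply: val_inj.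
by rewrite tpermL vconsS; apply: hx.
Qed.
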